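(* Let $n\ge1$ be an integer. Let $(R_t)_{t=1}^\infty$ be a sequence of $M_t\times N_t$ rectangles such that $M_t\to\infty$ and $N_t\to\infty$ as $t\to\infty$, and such that every $R_t$ is tileable by $n$-ribbons. Then the limit $\mu^{(n)}(R_t)=\lim_{t\to\infty}\frac{\log_2|\mathcal{T}_n(R_t)|}{M_tN_t/n}$ satisfies $$\mu^{(n)}(R_t)\ \le\ \log_2 n+\log_2 e .$$
   Context: An $M\times N$ rectangle is the rectangle made of unit squares of the square lattice with $M$ rows and $N$ columns. An $n$-ribbon is a connected sequence of $n$ unit squares of the lattice, each of which (except the first) lies directly above or directly to the right of its predecessor. A tiling of a region by $n$-ribbons is a set of $n$-ribbons with pairwise disjoint interiors whose union is the region; a region is tileable if it has at least one such tiling. $\mathcal{T}_n(R)$ is the set of all tilings of $R$ by $n$-ribbons. It is a known fact that, under the stated hypotheses, the limit defining $\mu^{(n)}(R_t)$ exists and is finite. *)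

(* Defs.v *)
From HB Require Import structures.
From mathcomp Require Import all_boot all_order all_algebra.

Set Implicit Arguments.
Unset Strict Implicit.
Unset Printing Implicit Defensive.

(* The cell (i, j) is the unit square in row i and column j; rows are numbered
   from bottom to top and columns from left to right. *)
Definition cell (M N : nat) : finType := ('I_M * 'I_N)%type.

(* [above_or_right a b]: b lies directly above or directly to the right of a. *)
Definition above_or_right (M N : nat) (a b : cell M N) : bool :=
  ((b.1 == a.1.+1 :> nat) && (b.2 == a.2 :> nat))
  || ((b.1 == a.1 :> nat) && (b.2 == a.2.+1 :> nat)).

(* A ribbon is identified with its set of cells; the sequence that runs through
   it is determined by that set, since row + column increases along it. *)
Definition ribbon (n M N : nat) (B : {set cell M N}) : bool :=
  [exists s : n.-tuple (cell M N),
     sorted (@above_or_right M N) s && (B == [set c in tval s])].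

(* [partition] also requires the blocks to be nonempty, which is automatic for
   n-ribbons when n >= 1. *)
Definition tilings (n M N : nat) : {set {set {set cell M N}}} :=
  [set P | partition P [set: cell M N] & [forall B in P, ribbon n B]].

Definition tileable (n M N : nat) : Prop :=
  exists P : {set {set cell M N}}, P \in tilings n M N.

From mathcomp Require Import all_classical all_reals all_analysis.

Import Order.TTheory GRing.Theory Num.Theory.
Import numFieldNormedType.Exports.

Local Open Scope ring_scope.

Definition log2 (R : realType) (x : R) : R := ln x / ln 2.

Definition entropy_density (R : realType) (n M N : nat) : R :=
  log2 (#|tilings n M N|%:R) / ((M * N)%:R / n%:R).

(* Main.v *)
(** A tiling is determined by the set of the first cells (roots) of its ribbons.
    Along an antidiagonal the ribbons never cross, so the cells of one
    antidiagonal that are not last in their ribbon are matched, in order, with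
    the cells of the next antidiagonal that are not roots.  There are
    [k = M N / n] roots, so the number of tilings is at most the binomial
    coefficient [C(k n, k)], and [C(k n, k) <= (1 + 1/n)^(k n) n^k <= (e n)^k]. *)
Require Import Defs.
From HB Require Import structures.
From mathcomp Require Import all_boot all_order all_algebra.
From mathcomp Require Import all_classical all_reals all_analysis.
From mathcomp Require Import zify lra.

Import Order.TTheory GRing.Theory Num.Theory.
Import numFieldNormedType.Exports.

Section RootMap.
(* Restores the finset meaning of names that the classical sets shadow. *)
Import mathcomp.boot.finset.
Set Implicit Arguments.
Unset Strict Implicit.
Unset Printing Implicit Defensive.
Local Open Scope nat_scope.
Variables n M N : nat.
Implicit Types (f g : cell M N -> cell M N) (c p q : cell M N).

(** * Antidiagonals and root maps *)

Definition level c : nat := c.1 + c.2.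

Lemma above_or_right_level c q : above_or_right c q -> level q = (level c).+1.
Proof. by rewrite /above_or_right /level; lia. Qed.

Lemma eq_cell c q : level c = level q -> c.2 = q.2 :> nat -> c = q.
Proof.
case: c q => [i j] [i' j']; rewrite /level /= => el ej.
by congr pair; apply: val_inj => /=; lia.
Qed.

(** What is kept of a tiling: the map from each cell to the first cell of its ribbon. The premise of
    [root_map_succ] says that [c] is not last in its ribbon. *)
Record root_map f : Prop := RootMap {
  root_map_idem : forall c, f (f c) = f c;
  root_map_level : forall c, level (f c) <= level c < level (f c) + n;
  root_map_inj : forall c q, f c = f q -> level c = level q -> c = q;
  root_map_pred : forall c, f c != c ->
    exists2 p, above_or_right p c & f p = f c;
  root_map_succ : forall c, (level c).+1 < level (f c) + n ->
    exists2 q, above_or_right c q & f q = f c }.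

(* If [c] continues [p] for [f] but continues the cell [p'] to the right of [p]
   for [g], then for [g] the cell [p] can only be continued by the cell [q]
   above it; [q] precedes [c] on its antidiagonal. *)
Lemma root_map_no_crossing f g c p p' : root_map f -> root_map g ->
  (forall q, level q = level c -> q.2 < c.2 -> f q = g q) ->
  above_or_right p c -> f p = f c -> above_or_right p' c -> g p' = g c ->
  f p = g p -> p.2 < p'.2 -> False.
Proof.
move=> hf hg IH pc fp p'c gp' fgp lt_pp'.
have lp := above_or_right_level pc.
have lp' := above_or_right_level p'c.
(* [p] is not last for [g]: it has the same root as for [f], and the [f]-ribbon reaches the next
   level at [c]. *)
have [|q pq gq] := @root_map_succ _ hg p.
  by rewrite -fgp fp -lp; case/andP: (root_map_level hf c).
have lq := above_or_right_level pq.
have neq_qc : q <> c.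
  move=> eqc; have e : p = p'.
    by apply: (root_map_inj hg); [rewrite gp' -eqc gq | lia].
  by rewrite e ltnn in lt_pp'.
apply: neq_qc; apply: (root_map_inj hf); last by lia.
have [e2|ne2] := eqVneq (q.2 : nat) (c.2 : nat).
  by rewrite (@eq_cell q c) //; lia.
rewrite IH; first by rewrite gq -fgp fp.
  by lia.
by move: pq pc p'c ne2; rewrite /above_or_right; lia.
Qed.

(** Away from roots each map copies its value from a predecessor, where both agree by induction;
    non-crossing forces the two predecessors to coincide. *)
Lemma root_map_ext f g : root_map f -> root_map g ->
  (forall c, (f c == c) = (g c == c)) -> f =1 g.
Proof.
move=> hf hg fgE c.
(* Since [c.2 < N], this measure orders cells by level, then by column. *)
have [m] := ubnP (level c * N + c.2).
elim: m c => // m IHm c ltm.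
have IHlevel p : above_or_right p c -> f p = g p.
  move=> /above_or_right_level lp; apply: IHm.
  by have := ltn_ord p.2; move: ltm; rewrite lp; nia.
have IHcol q : level q = level c -> q.2 < c.2 -> f q = g q.
  by move=> lq lt_qc; apply: IHm; rewrite lq; lia.
have [fc|fc] := eqVneq (f c) c.
  by apply/eqP; rewrite fc eq_sym -fgE fc.
have [p pc fp] := root_map_pred hf fc.
have [p' p'c gp'] : exists2 p', above_or_right p' c & g p' = g c.
  by apply: (root_map_pred hg); rewrite -fgE.
have lp := above_or_right_level pc.
have lp' := above_or_right_level p'c.
case: (ltngtP p.2 p'.2) => [lt_pp'|gt_pp'|eq_pp'].
- by case: (@root_map_no_crossing f g c p p') => //; exact: IHlevel.
- case: (@root_map_no_crossing g f c p' p) => //.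
    by move=> q lq lt_qc; rewrite IHcol.
  by rewrite IHlevel.
- have epp' : p = p' by apply: eq_cell => //; lia.
  by rewrite -fp -gp' -epp' IHlevel.
Qed.

(** * Ribbons and roots of a tiling *)

Lemma ribbon_path (B : {set cell M N}) : 0 < n -> ribbon n B ->
  exists h : nat -> cell M N,
    [/\ forall c, c \in B <-> exists2 k, k < n & c = h k,
        forall k, k < n -> level (h k) = level (h 0) + k
      & forall k, k.+1 < n -> above_or_right (h k) (h k.+1)].
Proof.
move=> n_gt0 /existsP[s /andP[s_sorted /eqP->]].
have x0 : cell M N by exact: (tnth s (Ordinal n_gt0)).
have step k : k.+1 < n -> above_or_right (nth x0 s k) (nth x0 s k.+1).
  by move=> lt_kn; apply: (sortedP x0) s_sorted _ _; rewrite size_tuple.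
exists (nth x0 s); split => //.
  move=> c; rewrite inE; split=> [/(nthP x0)|[k lt_kn ->]].
    by rewrite size_tuple => -[k ? <-]; exists k.
  by apply: mem_nth; rewrite size_tuple.
elim=> [|k IHk] lt_kn; first by rewrite addn0.
by rewrite (above_or_right_level (step _ lt_kn)) IHk ?addnS // ltnW.
Qed.

(** A ribbon meets an antidiagonal at most once, so in a tiling the minimum is attained only at its
    first cell. *)
Definition root (P : {set {set cell M N}}) c : cell M N :=
  [arg min_(q < c in pblock P c) level q].

Definition roots (P : {set {set cell M N}}) : {set cell M N} :=
  [set c | root P c == c].

Section Tiling.
Variable P : {set {set cell M N}}.
Hypotheses (n_gt0 : 0 < n) (P_tiling : P \in tilings n M N).

Let P_part : partition P [set: cell M N].
Proof. by move: P_tiling; rewrite inE => /andP[]. Qed.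

Let P_triv : trivIset P. Proof. by case/and3P: P_part. Qed.

Let P_cover c : c \in cover P.
Proof. by rewrite (cover_partition P_part) inE. Qed.

Let P_ribbon c : ribbon n (pblock P c).
Proof.
move: P_tiling; rewrite inE => /andP[_ /forall_inP]; apply.
exact: pblock_mem.
Qed.

Let root_in c : root P c \in pblock P c.
Proof.
by rewrite /root; case: arg_minnP => [|q //]; rewrite mem_pblock.
Qed.

Lemma pblock_root c : pblock P (root P c) = pblock P c.
Proof. exact/same_pblock/root_in. Qed.

Lemma root_path c : exists h : nat -> cell M N,
  [/\ forall q, q \in pblock P c <-> exists2 k, k < n & q = h k,
      forall k, k < n -> level (h k) = level (h 0) + k,
      forall k, k.+1 < n -> above_or_right (h k) (h k.+1)
    & forall q, q \in pblock P c -> root P q = h 0].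
Proof.
have [h [hP hlevel hstep]] := ribbon_path n_gt0 (P_ribbon c).
exists h; split=> // q qc; rewrite /root (same_pblock P_triv qc).
case: arg_minnP => // r /hP[k lt_kn ->] /(_ (h 0)).
have h0 : h 0 \in pblock P c by apply/hP; exists 0.
move=> /(_ h0); rewrite (hlevel k) //.
by case: k lt_kn => // k _; lia.
Qed.

Lemma eq_root c q : (root P c == root P q) = (pblock P c == pblock P q).
Proof.
apply/eqP/eqP => [e|e]; first by rewrite -pblock_root e pblock_root.
have [h [_ _ _ hroot]] := root_path c.
by rewrite !hroot // ?mem_pblock // e mem_pblock.
Qed.

Lemma root_map_root : root_map (root P).
Proof.
have self c : c \in pblock P c by rewrite mem_pblock.
split=> [c|c|c q e|c|c].
- by apply/eqP; rewrite eq_root pblock_root.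
- have [h [hP hlevel _ hroot]] := root_path c.
  have /hP[k lt_kn ec] := self c.
  by rewrite hroot // ec (hlevel k) //; lia.
- move/eqP: e; rewrite eq_root => /eqP e.
  have [h [hP hlevel _ _]] := root_path c.
  have /hP[k lt_kn ->] := self c.
  have : q \in pblock P c by rewrite e.
  move=> /hP[l lt_ln ->]; rewrite (hlevel k) // (hlevel l) // => ekl.
  by congr h; lia.
- have [h [hP _ hstep hroot]] := root_path c.
  have /hP[k lt_kn ec] := self c.
  rewrite hroot //; case: k => [|k] in lt_kn ec *; first by rewrite ec eqxx.
  move=> _; exists (h k); first by rewrite ec; exact: hstep.
  by apply: hroot; apply/hP; exists k => //; exact: ltnW.
- have [h [hP hlevel hstep hroot]] := root_path c.
  have /hP[k lt_kn ec] := self c.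
  rewrite hroot // {1}ec hlevel // -addnS ltn_add2l => lt_k1n.
  exists (h k.+1); first by rewrite ec; exact: hstep.
  by apply: hroot; apply/hP; exists k.+1.
Qed.

Lemma tiling_blocks : P = [set pblock P c | c in roots P].
Proof.
apply/setP=> B; apply/idP/imsetP => [BP|[c _ ->]]; last exact: pblock_mem.
have /set0Pn[c cB] := partition_neq0 P_part BP.
exists (root P c); first by rewrite inE (root_map_idem root_map_root).
by rewrite pblock_root (def_pblock P_triv BP cB).
Qed.

(** Roots correspond one to one to blocks, and a block has [n] cells because levels along its path
    are distinct. *)
Lemma card_roots : (#|roots P| * n = M * N)%N.
Proof.
have <- : #|P| = #|roots P|.
  rewrite {1}tiling_blocks card_in_imset // => c q.
  rewrite !inE => /eqP rc /eqP rq /eqP; rewrite -eq_root rc rq.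
  by move/eqP.
have -> : (M * N)%N = #|[set: cell M N]|.
  by rewrite cardsT card_prod !card_ord.
rewrite -(@card_uniform_partition _ n P [set: cell M N]) // => B BP.
have /set0Pn[c cB] := partition_neq0 P_part BP.
have [h [hP hlevel _ _]] := root_path c.
have hinj : injective (fun k : 'I_n => h k).
  move=> k l e; apply: val_inj; have := congr1 level e.
  by rewrite (hlevel k) ?(hlevel l) //=; lia.
rewrite -(def_pblock P_triv BP cB) -[n in RHS]card_ord -(card_codom hinj).
apply: eq_card => q; apply/idP/codomP => [/hP[k lt_kn ->]|[k ->]].
  by exists (Ordinal lt_kn).
by apply/hP; exists k.
Qed.

End Tiling.

(** * Counting tilings by their root sets *)

Lemma roots_inj : 0 < n -> {in tilings n M N &, injective roots}.
Proof.
move=> n_gt0 P Q hP hQ eroots.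
have e : root P =1 root Q.
  apply: root_map_ext; [exact: root_map_root|exact: root_map_root|].
  by move=> c; have /setP/(_ c) := eroots; rewrite !inE.
rewrite (tiling_blocks n_gt0 hP) (tiling_blocks n_gt0 hQ) eroots.
apply: eq_imset => c; apply/setP => q.
(* The blocks are the fibres of the root map. *)
have mem_block O : O \in tilings n M N ->
    (q \in pblock O c) = (root O c == root O q).
  move=> hO; have Opart : partition O [set: cell M N].
    by move: hO; rewrite inE => /andP[].
  rewrite eq_root // eq_pblock //; first by case/and3P: Opart.
  by rewrite (cover_partition Opart) inE.
by rewrite !mem_block // !e.
Qed.

Lemma card_tilings k : 0 < n -> (k * n = M * N)%N ->
  #|tilings n M N| <= 'C(k * n, k).
Proof.
move=> n_gt0 ek; rewrite -(card_in_imset (roots_inj n_gt0)).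
have -> : (k * n)%N = #|cell M N| by rewrite ek card_prod !card_ord.
rewrite -card_draws; apply/subset_leq_card/fintype.subsetP => S.
move=> /imsetP[P hP ->]; rewrite inE -(eqn_pmul2r n_gt0) ek.
by rewrite card_roots.
Qed.

End RootMap.

(** * Binomial estimate and passage to the limit *)

Local Open Scope ring_scope.

Lemma bin_expn_le m n k : ('C(m, k) * n ^ (m - k) <= n.+1 ^ m)%N.
Proof.
have [lt_mk|le_km] := ltnP m k; first by rewrite bin_small.
(* Only the term of index [k] in the expansion of [(n + 1) ^ m] is kept. *)
rewrite -addn1 expnDn (bigD1 (inord k)) //= inordK // exp1n muln1.
exact: leq_addr.
Qed.

Lemma ln_bin_le (R : realType) (n k : nat) : (0 < n)%N ->
  ln ('C(k * n, k)%:R : R) <= k%:R * (ln n%:R + 1).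
Proof.
move=> n_gt0; have n_pos : 0 < n%:R :> R by rewrite ltr0n.
have le_k : (k <= k * n)%N by rewrite leq_pmulr.
have bin_pos : 0 < 'C(k * n, k)%:R :> R by rewrite ltr0n bin_gt0.
have n1_pos : 0 < n.+1%:R :> R by rewrite ltr0n.
have ln1n : ln (n.+1%:R : R) <= ln n%:R + n%:R^-1.
  have -> : n.+1%:R = n%:R * (1 + n%:R^-1) :> R.
    by rewrite mulrDr mulr1 divff ?gt_eqF // natr1.
  rewrite lnM ?posrE ?addr_gt0 ?invr_gt0 // lerD2l.
  by apply: le_ln1Dx; rewrite (lt_trans (ltrN10 _)) // invr_gt0.
have : ('C(k * n, k) * n ^ (k * n - k))%:R <= (n.+1 ^ (k * n))%:R :> R.
  by rewrite ler_nat bin_expn_le.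
rewrite natrM !natrX -ler_ln ?posrE ?mulr_gt0 ?exprn_gt0 //.
rewrite lnM ?posrE ?exprn_gt0 // !lnXn // => le_bin.
(* The [k * n] factors [1 + 1/n] cost at most [k] in total; subtracting [(k * n - k) * ln n] then
   leaves [k * (ln n + 1)]. *)
have L_le : ln (n.+1%:R : R) * (k%:R * n%:R) <= ln n%:R * (k%:R * n%:R) + k%:R.
  apply: le_trans (ler_wpM2r _ ln1n) _; first by rewrite mulr_ge0.
  by rewrite mulrDl [n%:R^-1 * _]mulrC mulfK ?gt_eqF.
move: le_bin; rewrite mulrnBr // -[ln n%:R *+ (k * n)]mulr_natr.
rewrite -[ln n%:R *+ k]mulr_natr -[ln n.+1%:R *+ (k * n)]mulr_natr natrM.
lra.
Qed.

Lemma entropy_density_le (R : realType) (n M N : nat) : (0 < n)%N ->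
  tileable n M N ->
  entropy_density R n M N <= log2 (n%:R : R) + log2 (expR 1 : R).
Proof.
move=> n_gt0 [P hP]; set k := #|roots P|.
have ek : (k * n)%N = (M * N)%N by exact: card_roots.
have n_neq0 : n%:R != 0 :> R by rewrite pnatr_eq0 -lt0n.
have ln2 : 0 < ln 2 :> R by rewrite ln_gt0 // ltr1n.
(* The normalisation [M * N / n] is exactly the number [k] of roots. *)
rewrite /entropy_density /log2 expRK -mulrDl -ek natrM mulfK //.
have [->|k_gt0] := posnP k.
  (* An empty rectangle has density [x / 0 = 0]. *)
  rewrite invr0 mulr0 divr_ge0 ?(ltW ln2) // addr_ge0 // ln_ge0 //.
  by rewrite ler1n.
rewrite ler_pdivrMr ?ltr0n // mulrAC ler_pM2r ?invr_gt0 // mulrC.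
apply: (le_trans _ (@ln_bin_le R n k n_gt0)).
rewrite ler_ln ?posrE ?ltr0n ?ler_nat; first exact: card_tilings.
  by apply/card_gt0P; exists P.
by rewrite bin_gt0 leq_pmulr.
Qed.

Local Open Scope classical_set_scope.

Theorem theorem2p4 (R : realType) (n : nat) (M N : nat -> nat) (mu : R)
    (n_ge1 : (1 <= n)%N)
    (M_oo : M t @[t --> \oo] --> \oo)
    (N_oo : N t @[t --> \oo] --> \oo)
    (MN_tileable : forall t : nat, (1 <= t)%N -> tileable n (M t) (N t))
    (mu_lim : entropy_density R n (M t) (N t) @[t --> \oo] --> mu) :
  mu <= log2 (n%:R : R) + log2 (expR 1 : R).
Proof.
rewrite -(cvg_lim (@Rhausdorff R) mu_lim).
apply: limr_le; first by apply/cvg_ex; exists mu.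
near=> t; apply: entropy_density_le => //; apply: MN_tileable.
(* Tileability is assumed from index 1 on, hence this threshold. *)
by near: t; exists 1%N.
Unshelve. all: by end_near.
Qed.
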